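(* Let $k\ge 0$ be a fixed integer, $\mu_k\in\mathbb{R}$ and $\nu_k>0$. Then $\mathcal{R}_I(z;\mu_k,\nu_k)$ is a rational spectral transformation of $\mathcal{R}_I(z)$, namely $$\mathcal{R}_I(z;\mu_k,\nu_k)\ \dot{=}\ \mathbf{M}_k(z)\,\mathcal{R}_I(z),$$ where $$\mathbf{M}_k(z)=\begin{bmatrix}\hat{\mathcal{S}}_k(z)\mathcal{P}_k(z)+\Lambda_k(z) & -\mathcal{Q}_k(z)\hat{\mathcal{S}}_k(z)\\ -\mathcal{S}_k(z)\mathcal{P}_k(z) & \Lambda_k(z)+\mathcal{S}_k(z)\mathcal{Q}_k(z)\end{bmatrix},$$ $$\hat{\mathcal{S}}_k(z)=-\mu_k\mathcal{Q}_k(z)-(\nu_k-1)\lambda_k(z-a_k)\mathcal{Q}_{k-1}(z),\qquad \mathcal{S}_k(z)=\mu_k\mathcal{P}_k(z)+(\nu_k-1)\lambda_k(z-a_k)\mathcal{P}_{k-1}(z).$$ That is, $\det\mathbf{M}_k(z)$ is not the zero polynomial and $$\mathcal{R}_I(z;\mu_k,\nu_k)=\frac{\big(\hat{\mathcal{S}}_k(z)\mathcal{P}_k(z)+\Lambda_k(z)\big)\mathcal{R}_I(z)-\mathcal{Q}_k(z)\hat{\mathcal{S}}_k(z)}{-\mathcal{S}_k(z)\mathcal{P}_k(z)\,\mathcal{R}_I(z)+\Lambda_k(z)+\mathcal{S}_k(z)\mathcal{Q}_k(z)} .$$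
   Context: Let $(c_n)_{n\ge0},(\lambda_n)_{n\ge0},(a_n)_{n\ge0}$ be complex sequences with $\lambda_n\neq0$ for $n\ge1$. The $R_I$ polynomials $\mathcal{P}_n$ are defined by $\mathcal{P}_{-1}=0$, $\mathcal{P}_0=1$ and $\mathcal{P}_{n+1}(z)=(z-c_n)\mathcal{P}_n(z)-\lambda_n(z-a_n)\mathcal{P}_{n-1}(z)$ for $n\ge0$ (with $\mathcal{P}_n(a_n)\neq 0$ for $n\ge 1$). The polynomials of the second kind $\mathcal{Q}_n$ are defined by $\mathcal{Q}_0=0$, $\mathcal{Q}_1=1$ and $\mathcal{Q}_{n+1}(z)=(z-c_n)\mathcal{Q}_n(z)-\lambda_n(z-a_n)\mathcal{Q}_{n-1}(z)$ for $n\ge1$; for $k=0$ put $\mathcal{Q}_{-1}:=0$. Set $\Lambda_n(z)=\prod_{j=1}^n\lambda_j(z-a_j)$, $\Lambda_0=1$. $\mathcal{R}_I(z)$ is the continued fraction $$\mathcal{R}_I(z)=\cfrac{1}{z-c_0-\cfrac{\lambda_1(z-a_1)}{z-c_1-\cfrac{\lambda_2(z-a_2)}{z-c_2-\cdots}}},$$ whose $n$-th convergent is $\mathcal{Q}_n(z)/\mathcal{P}_n(z)$. $\mathcal{R}_I(z;\mu_k,\nu_k)$ is the continued fraction obtained from it by replacing, at the single level $k$, $c_k$ by $c_k+\mu_k$ and $\lambda_k$ by $\nu_k\lambda_k$, all other coefficients being unchanged (for $k=0$ only $c_0$ is affected, since $\lambda_0$ does not occur). A continued fraction is identified with the limit of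 its convergents (the denominators being nonzero for all large $n$), and the identity is understood as an identity between functions of $z$, at points where both continued fractions converge and the denominator on the right does not vanish. Notation: for a matrix $\mathbf{A}(z)=\begin{bmatrix}a(z)&b(z)\\c(z)&d(z)\end{bmatrix}$ of polynomials with $a(z)d(z)-b(z)c(z)\neq0$ (as a polynomial), $r(z)\,\dot{=}\,\mathbf{A}(z)u(z)$ means $r(z)=\dfrac{a(z)u(z)+b(z)}{c(z)u(z)+d(z)}$; one then says that $r$ is a (pure) rational spectral transformation of $u$. *)

(* Defs.v *)
From mathcomp Require Import all_boot all_order all_algebra.
From mathcomp Require Import all_classical all_reals all_analysis complex ring.

Set Implicit Arguments.
Unset Strict Implicit.
Unset Printing Implicit Defensive.

Import Order.TTheory GRing.Theory Num.Theory numFieldNormedType.Exports.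

Local Open Scope classical_set_scope.
Local Open Scope ring_scope.
Local Open Scope complex_scope.

Section RI.
Variable R : realType.
Implicit Types (c l a : nat -> R[i]) (z : R[i]) (n k : nat).

(* [p_(n-1)], with the convention [p_(-1) = 0]. *)
Definition poly_prev (p : nat -> {poly R[i]}) n : {poly R[i]} :=
  if n is n'.+1 then p n' else 0.

Definition RI_fac l a n : {poly R[i]} := l n *: ('X - (a n)%:P).

Fixpoint RI_P c l a n : {poly R[i]} :=
  match n with
  | 0 => 1
  | n'.+1 => ('X - (c n')%:P) * RI_P c l a n'
             - RI_fac l a n' * (if n' is n''.+1 then RI_P c l a n'' else 0)
  end.

(* Unlike for [RI_P], the recurrence only starts at [Q_2]. *)
Fixpoint RI_Q c l a n : {poly R[i]} :=
  match n with
  | 0 => 0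
  | n'.+1 => if n' is n''.+1 then
               ('X - (c n')%:P) * RI_Q c l a n' - RI_fac l a n' * RI_Q c l a n''
             else 1
  end.

Definition RI_Lambda l a n : {poly R[i]} := \prod_(1 <= j < n.+1) RI_fac l a j.

(* [R[i]^o] is the complex field with the topology of its modulus. *)
Definition RI_convergent c l a z : nat -> R[i]^o :=
  fun n => (RI_Q c l a n).[z] / (RI_P c l a n).[z].

Definition RI_dom c l a : set R[i] :=
  [set z | (\forall n \near \oo, (RI_P c l a n).[z] != 0)
           /\ cvgn (RI_convergent c l a z)].

(* The continued fraction as a function; meaningful on [RI_dom c l a] only. *)
Definition RI_cf c l a z : R[i] := limn (RI_convergent c l a z).

Definition perturb_c c k (mu : R) : nat -> R[i] :=
  fun n => if n == k then c n + mu%:C else c n.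

(* For [k = 0] only [l 0] changes, on which [RI_P] and [RI_Q] do not depend. *)
Definition perturb_l l k (nu : R) : nat -> R[i] :=
  fun n => if n == k then nu%:C * l n else l n.

Definition mx22 (T : Type) (x y s t : T) : 'M[T]_2 :=
  \matrix_(i < 2, j < 2)
    if i == ord0 then if j == ord0 then x else y
    else if j == ord0 then s else t.

(* [r] is the transform by [A] of [u], as functions on the points of [D] where
   the denominator does not vanish. *)
Definition spectral_transformation (D : set R[i]) (r : R[i] -> R[i])
    (A : 'M[{poly R[i]}]_2) (u : R[i] -> R[i]) : Prop :=
  \det A != 0 /\
  forall z, D z ->
    (A ord_max ord0).[z] * u z + (A ord_max ord_max).[z] != 0 ->
    r z = ((A ord0 ord0).[z] * u z + (A ord0 ord_max).[z])
          / ((A ord_max ord0).[z] * u z + (A ord_max ord_max).[z]).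

Definition RI_Shat c l a k (mu nu : R) : {poly R[i]} :=
  - (mu%:C *: RI_Q c l a k)
  - (nu - 1)%:C *: (RI_fac l a k * poly_prev (RI_Q c l a) k).

Definition RI_S c l a k (mu nu : R) : {poly R[i]} :=
  mu%:C *: RI_P c l a k
  + (nu - 1)%:C *: (RI_fac l a k * poly_prev (RI_P c l a) k).

Definition RI_M c l a k (mu nu : R) : 'M[{poly R[i]}]_2 :=
  mx22 (RI_Shat c l a k mu nu * RI_P c l a k + RI_Lambda l a k)
       (- (RI_Q c l a k * RI_Shat c l a k mu nu))
       (- (RI_S c l a k mu nu * RI_P c l a k))
       (RI_Lambda l a k + RI_S c l a k mu nu * RI_Q c l a k).

(* [RI_tail c l a z m j] is the finite continued fraction
   z - c_j - l_(j+1) (z - a_(j+1)) / (z - c_(j+1) - ... / (z - c_(j+m))). *)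
Fixpoint RI_tail c l a z m j : R[i] :=
  z - c j - (if m is m'.+1
             then l j.+1 * (z - a j.+1) / RI_tail c l a z m' j.+1 else 0).

Lemma RI_tail_rec c l a z (u : nat -> R[i]) m j :
  (forall n, u n.+2 = (z - c n.+1) * u n.+1
                      - l n.+1 * (z - a n.+1) * u n) ->
  (forall i, (i < m)%N -> RI_tail c l a z (m - i.+1) (j + i).+2 != 0) ->
  u (j + m).+2 = (\prod_(i < m) RI_tail c l a z (m - i.+1) (j + i).+2)
    * (RI_tail c l a z m j.+1 * u j.+1 - l j.+1 * (z - a j.+1) * u j).
Proof.
move=> ur; elim: m j => [|m IH] j h.
  by rewrite big_ord0 mul1r addn0 ur /= subr0.
rewrite addnS -addSn IH; last first.
  by move=> i im; have := h i.+1 im; rewrite addnS.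
have h0 : RI_tail c l a z m j.+2 != 0.
  by have := h 0%N isT; rewrite subn1 addn0.
rewrite big_ord_recl /= subn1 addn0 /=.
have -> : \prod_(i < m) RI_tail c l a z (m.+1 - (bump 0 i).+1) (j + bump 0 i).+2
    = \prod_(i < m) RI_tail c l a z (m - i.+1) (j.+1 + i).+2.
  by apply: eq_bigr => i _; rewrite /bump /= add1n subSS addSnnS.
by rewrite ur; field.
Qed.

(* The convergents are the truncations of the displayed continued fraction. *)
Lemma RI_convergentE c l a z n :
  (forall i, (i <= n)%N -> RI_tail c l a z (n - i) i != 0) ->
  RI_convergent c l a z n.+1 = (RI_tail c l a z n 0)^-1.
Proof.
case: n => [|n] h; first by rewrite /RI_convergent /= /RI_fac !(hornerE, subr0, mul1r).
pose Pz i := (RI_P c l a i).[z]; pose Qz i := (RI_Q c l a i).[z].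
have rP i : Pz i.+2 = (z - c i.+1) * Pz i.+1 - l i.+1 * (z - a i.+1) * Pz i.
  by rewrite /Pz /= /RI_fac !hornerE.
have rQ i : Qz i.+2 = (z - c i.+1) * Qz i.+1 - l i.+1 * (z - a i.+1) * Qz i.
  by rewrite /Qz /= /RI_fac !hornerE.
have h' i : (i < n)%N -> RI_tail c l a z (n - i.+1) (0 + i).+2 != 0.
  by move=> ilt; rewrite add0n -subSS; apply: h.
have := RI_tail_rec rP h'; have := RI_tail_rec rQ h'; rewrite add0n.
set p := \prod_(i < n) _ => eQ eP.
have p0 : p != 0 by apply/prodf_neq0 => i _; apply: h'.
have t1 : RI_tail c l a z n 1 != 0 by have := h 1%N isT; rewrite subn1.
have t0 : RI_tail c l a z n.+1 0 != 0 by have := h 0%N isT; rewrite subn0.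
rewrite /RI_convergent -/(Pz n.+2) -/(Qz n.+2) eQ eP.
have -> : Qz 1 = 1 by rewrite /Qz hornerE.
have -> : Qz 0 = 0 by rewrite /Qz hornerE.
have -> : Pz 0 = 1 by rewrite /Pz hornerE.
have -> : Pz 1 = z - c 0 by rewrite /Pz /= !hornerE subr0.
have -> : RI_tail c l a z n 1 * (z - c 0) - l 1 * (z - a 1) * 1
          = RI_tail c l a z n 1 * RI_tail c l a z n.+1 0.
  by rewrite /=; field.
by rewrite mulr1 mulr0 subr0 mulrA invfM mulrA mulfV ?mul1r ?mulf_neq0.
Qed.

End RI.

(* Main.v *)
(* Past level [k] the perturbed and unperturbed sequences solve the same
   three-term recurrence, so [Q'_n] and [P'_n] are combinations of [Q_n] and
   [P_n] with coefficients independent of [n]. The values at [n = k, k+1] and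
   the Casoratian [P_k Q_(k+1) - P_(k+1) Q_k = Lambda_k] identify the matrix of
   coefficients as [M_k / Lambda_k]; dividing and letting [n] tend to infinity
   gives the formula where [Lambda_k(z) != 0]. Where [Lambda_k(z) = 0], the
   vectors [(P_n, Q_n)(z)], [n >= k], are parallel, so [P_k R_I = Q_k] there and
   the denominator [- S_k (P_k R_I - Q_k) + Lambda_k] vanishes. *)
Require Import Defs.
From mathcomp Require Import all_boot all_order all_algebra.
From mathcomp Require Import all_classical all_reals all_analysis complex.
From mathcomp Require Import ring.

Set Implicit Arguments.
Unset Strict Implicit.
Unset Printing Implicit Defensive.

Import Order.TTheory GRing.Theory Num.Theory numFieldNormedType.Exports.

Local Open Scope classical_set_scope.
Local Open Scope ring_scope.
Local Open Scope complex_scope.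

(** An identity between two solutions of one three-term recurrence then needs checking at two
    indices only. *)
Lemma rec2_unique (A : pzRingType) (p q u v : nat -> A) :
  (forall n, u n.+2 = p n * u n.+1 - q n * u n) ->
  (forall n, v n.+2 = p n * v n.+1 - q n * v n) ->
  u 0%N = v 0%N -> u 1%N = v 1%N -> u =1 v.
Proof.
move=> ru rv e0 e1 n; suff [] : u n = v n /\ u n.+1 = v n.+1 by [].
by elim: n => [//|n [IH0 IH1]]; split=> //; rewrite ru rv IH0 IH1.
Qed.

Section Perturbation.
Variable R : realType.
Implicit Types (c l a : nat -> R[i]) (z : R[i]) (n k m : nat) (mu nu : R).

(** * Recurrences and the Casoratian *)

Lemma RI_PSS c l a n :
  RI_P c l a n.+2 = ('X - (c n.+1)%:P) * RI_P c l a n.+1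
                    - RI_fac l a n.+1 * RI_P c l a n.
Proof. by []. Qed.

Lemma RI_QSS c l a n :
  RI_Q c l a n.+2 = ('X - (c n.+1)%:P) * RI_Q c l a n.+1
                    - RI_fac l a n.+1 * RI_Q c l a n.
Proof. by []. Qed.

Lemma RI_LambdaS l a n :
  RI_Lambda l a n.+1 = RI_Lambda l a n * RI_fac l a n.+1.
Proof. by rewrite /RI_Lambda big_nat_recr. Qed.

Lemma RI_casoratian c l a n :
  RI_P c l a n * RI_Q c l a n.+1 - RI_P c l a n.+1 * RI_Q c l a n
  = RI_Lambda l a n.
Proof.
elim: n => [|n IH]; first by rewrite /RI_Lambda big_geq //= mulr1 mulr0 subr0.
rewrite RI_LambdaS -IH RI_PSS RI_QSS; ring.
Qed.

(** * Effect of the perturbation on the polynomials *)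

Lemma perturb_cE c k mu : perturb_c c k mu k = c k + mu%:C.
Proof. by rewrite /perturb_c eqxx. Qed.

Lemma perturb_c_neq c k mu n : n != k -> perturb_c c k mu n = c n.
Proof. by rewrite /perturb_c => /negPf ->. Qed.

Lemma RI_fac_perturbE l a k nu :
  RI_fac (perturb_l l k nu) a k = nu%:C *: RI_fac l a k.
Proof. by rewrite /RI_fac /perturb_l eqxx scalerA. Qed.

Lemma RI_fac_perturb_neq l a k nu n :
  n != k -> RI_fac (perturb_l l k nu) a n = RI_fac l a n.
Proof. by rewrite /RI_fac /perturb_l => /negPf ->. Qed.

Lemma RI_P_perturb_le c l a k mu nu n : (n <= k)%N ->
  RI_P (perturb_c c k mu) (perturb_l l k nu) a n = RI_P c l a n.
Proof.
elim/ltn_ind: n => -[|[|n]] IH // nk; last first.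
  rewrite !RI_PSS perturb_c_neq ?RI_fac_perturb_neq ?ltn_eqF //.
  by rewrite !IH // ltnW // ltnW.
by rewrite /= perturb_c_neq ?ltn_eqF // !mulr0.
Qed.

Lemma RI_Q_perturb_le c l a k mu nu n : (n <= k)%N ->
  RI_Q (perturb_c c k mu) (perturb_l l k nu) a n = RI_Q c l a n.
Proof.
elim/ltn_ind: n => -[|[|n]] IH // nk.
rewrite !RI_QSS perturb_c_neq ?RI_fac_perturb_neq ?ltn_eqF //.
by rewrite !IH // ltnW // ltnW.
Qed.

(** Only the step from [k] to [k.+1] sees the altered coefficients, and its inputs of index [k] and
    [k - 1] are still the original polynomials. The defect of this step is the origin of [RI_S], as
    that for [Q] is of [RI_Shat]. *)
Lemma RI_P_perturbS c l a k mu nu :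
  RI_P (perturb_c c k mu) (perturb_l l k nu) a k.+1
  = RI_P c l a k.+1 - RI_S c l a k mu nu.
Proof.
rewrite /RI_S; case: k => [|k].
  by rewrite /= perturb_cE -!mul_polyC polyCD; ring.
rewrite !RI_PSS perturb_cE RI_fac_perturbE !RI_P_perturb_le //= rmorphB rmorph1.
rewrite -!mul_polyC !(polyCD, polyCN); ring.
Qed.

Lemma RI_Q_perturbS c l a k mu nu :
  RI_Q (perturb_c c k mu) (perturb_l l k nu) a k.+1
  = RI_Q c l a k.+1 + RI_Shat c l a k mu nu.
Proof.
rewrite /RI_Shat; case: k => [|k]; first by rewrite /= !(mulr0, scaler0); ring.
rewrite !RI_QSS perturb_cE RI_fac_perturbE !RI_Q_perturb_le //= rmorphB rmorph1.
rewrite -!mul_polyC !(polyCD, polyCN); ring.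
Qed.

(** Both sides, as sequences in [m], solve the original recurrence shifted by [k]. Multiplying by
    [RI_Lambda l a k] instead of dividing keeps the identity polynomial. *)
Lemma RI_P_perturb c l a k mu nu m :
  RI_Lambda l a k * RI_P (perturb_c c k mu) (perturb_l l k nu) a (k + m)
  = - (RI_S c l a k mu nu * RI_P c l a k) * RI_Q c l a (k + m)
    + (RI_Lambda l a k + RI_S c l a k mu nu * RI_Q c l a k) * RI_P c l a (k + m).
Proof.
pose p n : {poly R[i]} := 'X - (c (k + n).+1)%:P.
pose q n := RI_fac l a (k + n).+1.
move: m; apply: (@rec2_unique _ p q) => [n|n||].
- rewrite !addnS RI_PSS perturb_c_neq ?RI_fac_perturb_neq; last 2 first.
  + by rewrite -addnS -[X in _ != X]addn0 eqn_add2l.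
  + by rewrite -addnS -[X in _ != X]addn0 eqn_add2l.
  rewrite /p /q; ring.
- by rewrite !addnS RI_PSS RI_QSS /p /q; ring.
- by rewrite addn0 RI_P_perturb_le //; ring.
(* With [RI_Lambda l a k] expanded as the Casoratian, the case [m = 1] is a ring identity. *)
- by rewrite addn1 RI_P_perturbS -(RI_casoratian c); ring.
Qed.

Lemma RI_Q_perturb c l a k mu nu m :
  RI_Lambda l a k * RI_Q (perturb_c c k mu) (perturb_l l k nu) a (k + m)
  = (RI_Shat c l a k mu nu * RI_P c l a k + RI_Lambda l a k) * RI_Q c l a (k + m)
    - RI_Q c l a k * RI_Shat c l a k mu nu * RI_P c l a (k + m).
Proof.
pose p n : {poly R[i]} := 'X - (c (k + n).+1)%:P.
pose q n := RI_fac l a (k + n).+1.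
move: m; apply: (@rec2_unique _ p q) => [n|n||].
- rewrite !addnS RI_QSS perturb_c_neq ?RI_fac_perturb_neq; last 2 first.
  + by rewrite -addnS -[X in _ != X]addn0 eqn_add2l.
  + by rewrite -addnS -[X in _ != X]addn0 eqn_add2l.
  rewrite /p /q; ring.
- by rewrite !addnS RI_PSS RI_QSS /p /q; ring.
- by rewrite addn0 RI_Q_perturb_le //; ring.
- by rewrite addn1 RI_Q_perturbS -(RI_casoratian c); ring.
Qed.

(** Agreement at [m = 0] is commutativity, at [m = 1] it is the vanishing of the Casoratian; the
    recurrence propagates it. *)
Lemma RI_casoratian_eq0 c l a k z m : (RI_Lambda l a k).[z] = 0 ->
  (RI_P c l a k).[z] * (RI_Q c l a (k + m)).[z]
  = (RI_Q c l a k).[z] * (RI_P c l a (k + m)).[z].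
Proof.
move=> L0; move: m.
apply: (@rec2_unique _ (fun n => z - c (k + n).+1)
                       (fun n => (RI_fac l a (k + n).+1).[z])) => [n|n||].
- by rewrite !addnS RI_QSS !(hornerD, hornerN, hornerM, hornerX, hornerC); ring.
- by rewrite !addnS RI_PSS !(hornerD, hornerN, hornerM, hornerX, hornerC); ring.
- by rewrite addn0 mulrC.
- apply/eqP; rewrite addn1 -subr_eq0 [X in _ - X]mulrC.
  by rewrite -!hornerM -hornerN -hornerD RI_casoratian L0.
Qed.

(** * The determinant of the transformation matrix *)

Lemma RI_Lambda_neq0 l a n :
  (forall j, (1 <= j)%N -> l j != 0) -> RI_Lambda l a n != 0.
Proof.
move=> hl; elim: n => [|n IH]; first by rewrite /RI_Lambda big_geq ?oner_neq0.
by rewrite RI_LambdaS mulf_neq0 // scaler_eq0 negb_or hl // polyXsubC_eq0.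
Qed.

(** The [mu] terms cancel; what is left is [nu - 1] times [RI_fac l a k] times the Casoratian at
    [k - 1]. *)
Lemma RI_ShatP_SQ c l a k mu nu :
  RI_Shat c l a k mu nu * RI_P c l a k + RI_S c l a k mu nu * RI_Q c l a k
  = if k is 0%N then 0 else (nu - 1)%:C *: RI_Lambda l a k.
Proof.
rewrite /RI_Shat /RI_S; case: k => [|k]; first by rewrite /= !(mulr0, scaler0); ring.
rewrite [poly_prev _ _]/= [poly_prev (RI_P c l a) _]/= RI_LambdaS.
by rewrite -(RI_casoratian c) -!mul_polyC; ring.
Qed.

Lemma det_RI_M c l a k mu nu :
  \det (RI_M c l a k mu nu)
  = (if k is 0%N then 1 else nu%:C) *: RI_Lambda l a k ^+ 2.
Proof.
rewrite /RI_M /mx22 (expand_det_row _ ord0) !big_ord_recl big_ord0 /cofactor !det_mx11 !mxE.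
rewrite /= addr0 expr0 expr1 mul1r mulN1r.
set L := RI_Lambda l a k; set S := RI_S _ _ _ _ _ _; set T := RI_Shat _ _ _ _ _ _.
(* The products of [T * RI_P c l a k] and [S * RI_Q c l a k] cancel between the two diagonals. *)
transitivity (L * (L + (T * RI_P c l a k + S * RI_Q c l a k))); first by ring.
rewrite RI_ShatP_SQ -/L; case: (k) => [|_]; first by rewrite scale1r; ring.
by rewrite rmorphB rmorph1 -!mul_polyC polyCB; ring.
Qed.

(** * Convergents and their limits *)

Lemma RI_convergent_perturb c l a k mu nu z m :
  (RI_Lambda l a k).[z] != 0 -> (RI_P c l a (k + m)).[z] != 0 ->
  let M := RI_M c l a k mu nu in
  RI_convergent (perturb_c c k mu) (perturb_l l k nu) a z (k + m)
  = ((M ord0 ord0).[z] * RI_convergent c l a z (k + m) + (M ord0 ord_max).[z])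
    / ((M ord_max ord0).[z] * RI_convergent c l a z (k + m)
       + (M ord_max ord_max).[z]).
Proof.
move=> L0 P0; rewrite /= !mxE /= /RI_convergent.
have /(congr1 (horner^~ z)) := RI_P_perturb c l a k mu nu m.
have /(congr1 (horner^~ z)) := RI_Q_perturb c l a k mu nu m.
rewrite /= ![(RI_Lambda l a k * _).[z]]hornerM.
rewrite !(hornerD _ _ z) !(hornerN, hornerM, hornerD).
move: L0 P0; set L := (RI_Lambda l a k).[z]; set P := (RI_P c l a (k + m)).[z].
set Q := (RI_Q c l a (k + m)).[z].
set P' := (RI_P _ _ _ (k + m)).[z]; set Q' := (RI_Q _ _ _ (k + m)).[z].
move=> L0 P0 eQ eP.
have LP0 : L / P != 0 by rewrite mulf_neq0 ?invr_neq0.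
(* The fraction is expanded by [L / P]. If [P'] vanishes, both sides are quotients by zero, hence
   both equal 0. *)
rewrite -[LHS]mulr1 -(divff LP0) mulf_div !(mulrCA _ L) ![L * (_ / _)]mulrA.
by rewrite eQ eP; congr (_ / _); field.
Qed.

Lemma RI_cf_degenerate c l a k z : RI_dom c l a z -> (RI_Lambda l a k).[z] = 0 ->
  (RI_P c l a k).[z] * RI_cf c l a z = (RI_Q c l a k).[z].
Proof.
move=> [P0 cv] L0.
have cvP : ((RI_P c l a k).[z] : R[i]^o) * RI_convergent c l a z n @[n --> \oo]
    --> ((RI_P c l a k).[z] : R[i]^o) * limn (RI_convergent c l a z).
  by apply: cvgM; [exact: cvg_cst | exact: cv].
rewrite /RI_cf; apply: (cvg_unique (@norm_hausdorff _ R[i]^o) cvP).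
(* The sequence is eventually constant, equal to [Q_k(z)]. *)
apply: cvg_near_cst.
near=> n; have kn : (k <= n)%N by near: n; exact: nbhs_infty_ge.
have Pn0 : (RI_P c l a n).[z] != 0 by near: n; exact: P0.
have := RI_casoratian_eq0 c (n - k) L0; rewrite subnKC // => e.
by rewrite /RI_convergent mulrA e mulfK.
Unshelve. all: by end_near. Qed.

End Perturbation.

Lemma homographic_limit (K : numFieldType) (u v : nat -> K^o) (p q r s : K) :
  cvgn u -> cvgn v ->
  (\forall n \near \oo, v n = (p * u n + q) / (r * u n + s)) ->
  r * limn u + s != 0 ->
  limn v = (p * limn u + q) / (r * limn u + s).
Proof.
move=> cu cv e d0.
have affine (x y : K) : (x * u n + y : K^o) @[n --> \oo] --> (x * limn u + y : K^o).
  apply: cvgD; last exact: cvg_cst.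
  by apply: cvgM; [exact: cvg_cst | exact: cu].
apply: (cvg_unique (@norm_hausdorff _ K^o) cv).
apply: (@cvg_trans _ (((p * u n + q) / (r * u n + s) : K^o) @[n --> \oo])).
  by apply: near_eq_cvg; apply: filterS e => n ->.
apply: (@cvgM K nat \oo _ (fun n => p * u n + q) (fun n => (r * u n + s)^-1)).
  exact: affine.
apply: (@cvgV K nat \oo _ (fun n => r * u n + s) _ d0).
exact: affine.
Qed.

Theorem theorem2p1 (R : realType) (c l a : nat -> R[i])
  (hl : forall n : nat, (1 <= n)%N -> l n != 0)
  (hPa : forall n : nat, (1 <= n)%N -> (RI_P c l a n).[a n] != 0)
  (k : nat) (mu nu : R) (hnu : 0 < nu) :
  spectral_transformation
    (RI_dom c l a `&` RI_dom (perturb_c c k mu) (perturb_l l k nu) a)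
    (RI_cf (perturb_c c k mu) (perturb_l l k nu) a)
    (RI_M c l a k mu nu)
    (RI_cf c l a).
Proof.
split.
  rewrite det_RI_M scaler_eq0 negb_or expf_neq0 ?RI_Lambda_neq0 // andbT.
  by case: (k) => [|_]; rewrite ?oner_neq0 // fmorph_eq0 gt_eqF.
move=> z [dz dz'] den0.
have [L0|L0] := eqVneq (RI_Lambda l a k).[z] 0.
  (* At a zero of [Lambda_k] this case contradicts [den0]. *)
  move: den0; rewrite !mxE /= !(hornerN, hornerM, hornerD) L0 add0r.
  by rewrite -(RI_cf_degenerate dz L0) mulNr mulrA addNr eqxx.
have [P0 cv] := dz; have [_ cv'] := dz'.
apply: (@homographic_limit _ (RI_convergent c l a z)
  (RI_convergent (perturb_c c k mu) (perturb_l l k nu) a z)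
  _ _ _ _ cv cv' _ den0).
(* The relation between convergents holds from index [k] on, wherever [P_n(z)] is nonzero. *)
near=> n; have kn : (k <= n)%N by near: n; exact: nbhs_infty_ge.
rewrite -(subnKC kn); apply: RI_convergent_perturb => //; rewrite subnKC //.
by near: n; exact: P0.
Unshelve. all: by end_near. Qed.
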